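(* Let $N\in\mathbb{N}$, let $M$ be a divisor of $N$, let $R=\tfrac{N}{M}$, and let $U$ be a random variable uniformly distributed on the set $[0:R]$. A random variable $X$ taking values in $\{0,\dots,N-1\}$ belongs to the domain of attraction of $\xi=M\cdot U$ if and only if there exists a random variable $Y$ taking values in $[0:R]$ such that $X=M\cdot Y$ and for all $a\in[0:R]$ and all $t_*=1,\dots,R-1$ one has $$\Pr\bigl((Y-a)\,t_*\,\%\,R=0\bigr)<1.$$
   Context: Notation: for a positive integer $K$, $[0:K]=\{0,1,\dots,K-1\}$, and $n\,\%\,K$ denotes the remainder of division of the integer $n$ by $K$. Let $\chi=[0:N]=\{0,\dots,N-1\}$ with the operation $x\oplus y=(x+y)\,\%\,N$. A random variable $X$ taking values in $\chi$ is said to belong to the domain of attraction of a random variable $\xi$ if $X_1\oplus\cdots\oplus X_m$ converges in distribution to $\xi$ as $m\to\infty$, where $X_1,X_2,\dots$ are independent copies of $X$. Divisors are positive divisors. *)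

(* Defs.v *)
From HB Require Import structures.
From mathcomp Require Import all_boot all_order all_algebra finmap.
From mathcomp Require Import all_classical all_reals all_analysis.

Set Implicit Arguments.
Unset Strict Implicit.
Unset Printing Implicit Defensive.

Import Order.TTheory GRing.Theory Num.Theory.
Import numFieldNormedType.Exports.

Local Open Scope classical_set_scope.
Local Open Scope ring_scope.

Definition addmod (N x y : nat) : nat := ((x + y) %% N)%N.

Definition independent_RVs (R : realType) d (T : measurableType d)
    (P : probability T R) d' (S : measurableType d') (I : choiceType)
    (X : I -> {RV P >-> S}) : Prop :=
  forall (J : {fset I}) (A : I -> set S),
    (forall i, i \in J -> measurable (A i)) ->
    P (\bigcap_(i in [set` J]) (X i @^-1` A i)) =
    (\prod_(i <- J) P (X i @^-1` A i))%E.

(* Portmanteau form: test functions are the bounded continuous f : S -> R.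
   The variables may live on different probability spaces. *)
Definition cvg_in_distribution (R : realType) (S : topologicalType)
    d (T : measurableType d) (P : probability T R) (X : nat -> T -> S)
    d' (T' : measurableType d') (P' : probability T' R) (xi : T' -> S) : Prop :=
  forall f : S -> R, continuous f -> (exists B : R, forall s, `|f s| <= B) ->
    ('E_P[f \o X m] @[m --> \oo] --> 'E_P'[f \o xi])%E.

(* [Xs i] stands for X_(i+1).  The sums converge or not depending on the law of
   [X] only, so it does not matter on which probability space the independent
   copies are taken; asking for one such space rules out a vacuous reading. *)
Definition in_domain_of_attraction (N : nat) (R : realType)
    d (T : measurableType d) (P : probability T R) (X : {RV P >-> nat})
    d' (T' : measurableType d') (P' : probability T' R) (xi : T' -> nat) :
    Prop :=
  exists d1 (T1 : measurableType d1) (P1 : probability T1 R)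
      (Xs : nat -> {RV P1 >-> nat}),
    [/\ independent_RVs Xs,
        forall i (A : set nat), distribution P1 (Xs i) A = distribution P X A &
        cvg_in_distribution P1
          (fun m t => \big[addmod N/0%N]_(i < m) Xs i t) P' xi].

(* The masses 1/K on {0, .., K-1} already add up to 1. *)
Definition uniform_below (K : nat) (R : realType) d (T : measurableType d)
    (P : probability T R) (U : {RV P >-> nat}) : Prop :=
  forall k, (k < K)%N -> P [set t | U t = k] = (K%:R^-1)%:E.

(* Main.v *)
Require Import Defs.
From HB Require Import structures.
From mathcomp Require Import all_boot all_order all_algebra finmap.
From mathcomp Require Import fingroup cyclic.
From mathcomp Require Import all_classical all_reals all_analysis.
From mathcomp Require Import measurable_realfun ring lra.

Set Implicit Arguments.
Unset Strict Implicit.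
Unset Printing Implicit Defensive.

Import Order.TTheory GRing.Theory Num.Theory.
Import numFieldNormedType.Exports.

Local Open Scope classical_set_scope.
Local Open Scope ring_scope.

(** The theorem is the equidistribution theorem for random walks on a finite
    abelian group, read in the group [G] of residues modulo [N]. Let [p] be the
    law of [X], a function on [G]; the sum of [m] independent copies of [X] has
    the [m]-fold convolution power of [p] as its law ([prob_sum]), and [M * U]
    is uniform on the subgroup [L] of the multiples of [M], which has [R]
    elements ([law_mul_uniform]). All the variables are bounded, so convergence
    in distribution is convergence of the mass functions
    ([cvg_in_distribution_nat]).

    The group theorem says that the convolution powers of [p] converge to the
    uniform law on [L] if and only if [p] is carried by [L] but by no coset
    [x + H] of a proper subgroup [H] of [L].

    - Sufficiency ([convpow_cvg]). The supports of the powers do not decrease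
      in size, so at some point the support [B] of a power has as many elements
      as the next one. Then all the translates of [B] by elements of the
      support of [p] coincide, so that the support of [p] lies in one coset of
      the stabiliser of [B]. This stabiliser is therefore [L], and [B = L]
      ([convpow_gt0]). A power that is bounded below by [delta > 0] on [L]
      contracts the distance to the uniform law by the factor
      [1 - R * delta < 1] ([convpow_contract]), so the convergence is
      geometric.

    - Necessity. If the uniform law on [L] is the limit and [p a > 0], then the
      limit at [a] is at least [p a] times the limit at [0], so that [a] is in
      [L] ([cvg_convpow_supp]). If [p] is carried by [x + H], the power of
      exponent [m] is carried by [m x + H], which is [H] as soon as [R] divides
      [m]; so the limit vanishes on the complement of [H] in [L]
      ([cvg_convpow_aperiodic]).

    The condition on [a] and [t] in the statement says that [p] is not carried
    by the coset of [M * a] modulo the subgroup of all [h] in [L] such that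
    [t h = 0]. It is proper because [t < R]. Conversely, a proper subgroup [H]
    of [L] is contained in the one obtained for [t = #|H|], which is less
    than [R].

    The definition of the domain of attraction also asks for a sequence of
    independent copies of [X] on some probability space. They are taken on
    [[0, 1[] with the Lebesgue measure: [[0, 1[] is cut into intervals whose
    lengths are the masses of [p], each of them is cut again in the same
    proportions, and so on; the [i]-th copy is the index of the interval chosen
    at step [i] ([iid_copy_law], [iid_copy_independent]). *)

(** * Convolution powers on a finite group *)

(** [convpow r m] is the [m]-fold convolution power of [r], that is, when [r]
    is a probability mass function, the law of a product of [m] independent
    factors of law [r]. *)
Fixpoint convpow (K : pzSemiRingType) (gT : finGroupType) (r : gT -> K)
    (m : nat) (g : gT) : K :=
  if m is m'.+1 then \sum_a r a * convpow r m' (a^-1 * g)%g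
  else (g == 1%g)%:R.

Lemma sum_convpow (K : pzSemiRingType) (gT : finGroupType) (r : gT -> K) m :
  \sum_a r a = 1 -> \sum_g convpow r m g = 1.
Proof.
move=> r1; elim: m => [|m IH] /=.
  by rewrite (bigD1 1%g)//= eqxx big1 ?addr0// => g /negPf->.
rewrite exchange_big/= -[RHS]r1; apply: eq_bigr => a _.
rewrite -mulr_sumr [X in _ * X](_ : _ = 1) ?mulr1//.
by rewrite -[RHS]IH [RHS](reindex_inj (mulgI a^-1%g)).
Qed.

Lemma convpowD (K : pzSemiRingType) (gT : finGroupType) (r : gT -> K) m n g :
  convpow r (m + n) g = \sum_a convpow r m a * convpow r n (a^-1 * g)%g.
Proof.
elim: m g => [|m IH] g.
  rewrite add0n (bigD1 1%g)//= eqxx mul1r invg1 mul1g big1 ?addr0//.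
  by move=> a /negPf->; rewrite mul0r.
rewrite addSn /=.
transitivity (\sum_a \sum_b
    r a * (convpow r m (a^-1 * b)%g * convpow r n (b^-1 * g)%g)).
  apply: eq_bigr => a _; rewrite IH -mulr_sumr; congr (_ * _).
  rewrite (reindex_inj (mulgI a^-1%g)); apply: eq_bigr => b _.
  by rewrite invMg invgK -!mulgA mulKVg.
rewrite exchange_big; apply: eq_bigr => b _; rewrite mulr_suml.
by apply: eq_bigr => a _; rewrite mulrA.
Qed.

Lemma convpow_ge0 (K : numDomainType) (gT : finGroupType) (r : gT -> K) m g :
  (forall a, 0 <= r a) -> 0 <= convpow r m g.
Proof.
move=> r0; elim: m g => [|m IH] g /=; first by rewrite ler0n.
by apply: sumr_ge0 => a _; apply: mulr_ge0.
Qed.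

Lemma convpow_gt0M (K : realDomainType) (gT : finGroupType) (r : gT -> K)
    m a g :
  (forall a, 0 <= r a) -> 0 < r a -> 0 < convpow r m g ->
  0 < convpow r m.+1 (a * g)%g.
Proof.
move=> r0 ra qg /=; rewrite (bigD1 a)//= mulKg.
apply: ltr_pwDl; first exact: mulr_gt0.
by apply: sumr_ge0 => b _; rewrite mulr_ge0 ?convpow_ge0.
Qed.

(** If [r] is carried by the coset [x *: H] of a subgroup of an abelian group,
    then its [m]-th convolution power is carried by [x ^+ m *: H]. *)
Lemma convpow_coset (K : realDomainType) (gT : finGroupType) (r : gT -> K)
    (L H : {group gT}) x m g :
  abelian L -> x \in L -> H \subset L ->
  (forall a, 0 <= r a) ->
  (forall a, 0 < r a -> (x^-1 * a)%g \in H) ->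
  0 < convpow r m g -> (x ^- m * g)%g \in H.
Proof.
move=> /centsP cLL xL /fintype.subsetP HL r0 rH; elim: m g => [|m IH] g /=.
  by rewrite invg1 mul1g; case: (g =P 1%g) => [->|]; rewrite ?group1// ltxx.
move=> qg.
have /existsP[a /andP[ra qa]] :
    [exists a, (0 < r a) && (0 < convpow r m (a^-1 * g)%g)].
  apply: contraLR qg => /existsPn nex; rewrite -leNgt.
  rewrite le_eqVlt big1 ?eqxx// => a _.
  have := nex a; rewrite negb_and !lt_neqAle r0 convpow_ge0// !andbT !negbK.
  by case/orP => /eqP <-; rewrite ?mul0r ?mulr0.
have h1 := rH _ ra; have h2 := IH _ qa.
have -> : (x ^- m.+1 * g = (x^-1 * a) * (x ^- m * (a^-1 * g)))%g.
  rewrite expgS invMg; set y := (x ^- m)%g.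
  have yL : y \in L by rewrite groupV groupX.
  have xaL : (x^-1 * a)%g \in L by apply: HL.
  have cy : commute y (x^-1 * a)%g by apply: cLL.
  rewrite [RHS]mulgA -cy -!mulgA; congr (_ * _)%g.
  by rewrite mulKVg.
exact: groupM.
Qed.

Section equidistribution.
Variables (K : realType) (gT : finGroupType) (r : gT -> K) (L : {group gT}).
Hypothesis r_ge0 : forall a, 0 <= r a.
Hypothesis r_sum1 : \sum_a r a = 1.

Local Notation q := (convpow r).

Let supp m : {set gT} := [set g | 0 < q m g].

Lemma pmf_gt0_ex (p : gT -> K) : (forall a, 0 <= p a) -> \sum_a p a = 1 ->
  exists a, 0 < p a.
Proof.
move=> p0 p1; apply/existsP; apply: contraT => /existsPn np.
have : \sum_a p a = 0.
  apply: big1 => a _; apply/eqP; rewrite eq_le p0 andbT leNgt; exact: np.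
by rewrite p1 => /eqP; rewrite oner_eq0.
Qed.

(** The cardinal of the support of a convolution power cannot increase
    forever. *)
Lemma supp_convpow_stable : exists m, #|supp m.+1| = #|supp m|.
Proof.
have le_supp m : (#|supp m| <= #|supp m.+1|)%N.
  have [a ra] := pmf_gt0_ex r_ge0 r_sum1.
  rewrite -(card_lcoset _ a); apply/subset_leq_card/fintype.subsetP => g.
  rewrite mem_lcoset !inE => /(convpow_gt0M r_ge0 ra).
  by rewrite mulKVg.
apply/not_existsP => /= ne.
have lt_supp m : (#|supp m| < #|supp m.+1|)%N.
  by rewrite ltn_neqAle le_supp andbT; apply/eqP => /esym; apply: ne.
have le_m m : (m <= #|supp m|)%N.
  by elim: m => // m IH; apply: leq_ltn_trans (lt_supp m).
have := leq_trans (le_m #|gT|.+1) (max_card _).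
by rewrite ltnn.
Qed.

Hypothesis r_supp : forall a, 0 < r a -> a \in L.

Lemma convpow_notin m g : g \notin L -> q m g = 0.
Proof.
elim: m g => [|m IH] g gL /=; first by case: eqP gL => // ->; rewrite group1.
apply: big1 => a _; have [aL|aL] := boolP (a \in L).
  by rewrite IH ?mulr0// groupMl ?groupV.
suff -> : r a = 0 by rewrite mul0r.
by apply/eqP; rewrite eq_le r_ge0 andbT leNgt; apply: contra aL; apply: r_supp.
Qed.

Lemma sum_group_convpow m : \sum_(g in L) q m g = 1.
Proof.
rewrite -(sum_convpow m r_sum1) [RHS](bigID (mem L))/=.
by rewrite [X in _ + X]big1 ?addr0// => g gL; rewrite convpow_notin.
Qed.

Hypothesis r_aperiodic : forall (H : {group gT}) x, H \proper L -> x \in L ->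
  exists2 a, 0 < r a & (x^-1 * a)%g \notin H.

(** Some convolution power charges all of [L]: when the support [B] of a power
    has the same size as the next one, all its translates by points of the
    support of [r] coincide, so that this support lies in one coset of the
    stabiliser of [B], which therefore is [L]. *)
Lemma convpow_gt0 : exists m, forall g, g \in L -> 0 < q m g.
Proof.
have [m eqm] := supp_convpow_stable; exists m => g gL.
have tr a : 0 < r a -> (a *: supp m)%g = supp m.+1.
  move=> ra; apply/eqP; rewrite eqEcard card_lcoset eqm leqnn andbT.
  apply/fintype.subsetP => h; rewrite mem_lcoset !inE => /(convpow_gt0M r_ge0 ra).
  by rewrite mulKVg.
pose S := [set h in L | (h *: supp m == supp m)%g].
have SG : group_set S.
  apply/group_setP; split; first by rewrite inE group1 lcoset1 eqxx.
  move=> x y; rewrite !inE => /andP[xL /eqP xS] /andP[yL /eqP yS].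
  by rewrite groupM//= lcosetM yS xS.
pose H := Group SG.
have HL : H \subset L by apply/fintype.subsetP => x; rewrite inE => /andP[].
have [b qb] := pmf_gt0_ex (convpow_ge0 m ^~ r_ge0) (sum_convpow m r_sum1).
have bL : b \in L.
  by apply: contraLR qb => /(convpow_notin m) ->; rewrite ltxx.
have [a ra] := pmf_gt0_ex r_ge0 r_sum1.
have [pHL|] := boolP (H \proper L).
  have [a' ra' /negP[]] := r_aperiodic pHL (r_supp ra).
  rewrite inE groupM ?groupV ?r_supp//= lcosetM (tr _ ra') -(tr _ ra).
  by rewrite -lcosetM mulVg lcoset1.
rewrite properE HL/= negbK => /fintype.subsetP LH.
have := LH (g * b^-1)%g; rewrite groupM ?groupV// inE => /(_ isT).
case/andP=> _ /eqP E.
have : g \in (g * b^-1 *: supp m)%g.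
  by rewrite mem_lcoset invMg invgK -mulgA mulVg mulg1 inE.
by rewrite E inE.
Qed.

Let u : K := #|L|%:R^-1.

(** Doeblin contraction: if [q n >= delta] on [L], convolving with [q n]
    shrinks the sup distance to the uniform law by the factor
    [1 - #|L| * delta]. *)
Lemma convpow_contract n delta m e :
  (forall g, g \in L -> delta <= q n g) ->
  (forall g, g \in L -> `|q m g - u| <= e) ->
  forall g, g \in L -> `|q (n + m) g - u| <= (1 - #|L|%:R * delta) * e.
Proof.
move=> qd qe g gL.
have L0 : (#|L|%:R : K) != 0 by rewrite pnatr_eq0 -lt0n cardG_gt0.
have sumc (c : K) : \sum_(a in L) c = #|L|%:R * c.
  by rewrite sumr_const mulr_natl.
have sumqV : \sum_(a in L) q m (a^-1 * g)%g = 1.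
  rewrite -(sum_group_convpow m) [RHS](reindex_inj (mulIg g)).
  rewrite [RHS](reindex_inj invg_inj) /=; apply: eq_bigl => a.
  by rewrite groupMr// groupV.
have -> : q (n + m) g - u
    = \sum_(a in L) (q n a - delta) * (q m (a^-1 * g)%g - u).
  rewrite convpowD (bigID (mem L))/= [X in _ + X - u]big1 ?addr0; last first.
    by move=> a aL; rewrite convpow_notin// mul0r.
  transitivity (\sum_(a in L) (q n a * q m (a^-1 * g)%g
      - q n a * u - delta * (q m (a^-1 * g)%g - u))); last first.
    by apply: eq_bigr => a _; ring.
  rewrite !sumrB -mulr_suml -mulr_sumr sumrB sum_group_convpow sumqV sumc.
  by rewrite /u divff//; ring.
apply: (le_trans (ler_norm_sum _ _ _)).
have -> : (1 - #|L|%:R * delta) * e = \sum_(a in L) (q n a - delta) * e.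
  by rewrite -mulr_suml sumrB sum_group_convpow sumc.
apply: ler_sum => a aL; rewrite normrM ger0_norm ?subr_ge0 ?qd//.
by rewrite ler_wpM2l ?subr_ge0 ?qd// qe// groupM ?groupV.
Qed.

Lemma convpow_cvg g : q m g @[m --> \oo] --> ((g \in L)%:R / #|L|%:R : K).
Proof.
have [gL|gL] := boolP (g \in L); last first.
  rewrite mul0r; under eq_fun do rewrite convpow_notin//.
  exact: cvg_cst.
rewrite mul1r.
have [n0 qn0] := convpow_gt0.
have /= cardL : (0 < #|L|%:R :> K) by rewrite ltr0n cardG_gt0.
(* one more step, so that [n] is positive and can be divided by *)
pose n := n0.+1.
have [delta [d0 qd]] : exists delta : K, 0 < delta /\
    forall g, g \in L -> delta <= q n g.
  have qn h : h \in L -> 0 < q n h.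
    move=> hL; have [a ra] := pmf_gt0_ex r_ge0 r_sum1.
    rewrite -(mulKVg a h); apply: convpow_gt0M => //; apply: qn0.
    by rewrite groupM ?groupV ?(r_supp ra).
  exists (\big[Num.min/1]_(h in L) q n h); split.
    by apply: lt_bigmin => //; exact: qn.
  by move=> h hL; apply: bigmin_le_cond.
pose rho := 1 - #|L|%:R * delta.
have rho1 : rho < 1 by rewrite /rho ltrBlDr ltrDl mulr_gt0.
have rho0 : 0 <= rho.
  rewrite /rho subr_ge0 mulr_natl -sumr_const.
  by rewrite -[leRHS](sum_group_convpow n); apply: ler_sum.
have bnd j i h : h \in L -> `|q (j * n + i)%N h - u| <= rho ^+ j.
  elim: j h => [|j IH] h hL; last first.
    by rewrite mulSn -addnA exprS; exact: (convpow_contract qd IH).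
  rewrite mul0n add0n expr0.
  have q0 : 0 <= q i h by apply: convpow_ge0.
  have q1 : q i h <= 1.
    rewrite -[leRHS](sum_group_convpow i) (bigD1 h)//= lerDl.
    by apply: sumr_ge0 => ? _; apply: convpow_ge0.
  have u0 : 0 <= u by rewrite invr_ge0 ltW.
  have u1 : u <= 1 by rewrite invf_le1// ler1n cardG_gt0.
  by rewrite ler_norml; apply/andP; split; lra.
apply/cvgrPdist_le => /= e e0.
have rho_cvg : rho ^+ j @[j --> \oo] --> (0 : K).
  by apply: cvg_expr; rewrite ger0_norm.
move/cvgrPdist_le : rho_cvg => /(_ _ e0)[J _ HJ].
exists (J * n)%N => // m /= Jm.
have /HJ : (J <= m %/ n)%N by rewrite leq_divRL.
rewrite sub0r normrN ger0_norm ?exprn_ge0// => lee.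
rewrite distrC (divn_eq m n); exact: le_trans (bnd _ _ _ gL) lee.
Qed.

End equidistribution.

(** The limit [l] of [convpow r] satisfies [r a * l 1 <= l a], because
    [r a * convpow r m 1] is a term of the sum [convpow r m.+1 a]. *)
Lemma cvg_convpow_supp (K : realType) (gT : finGroupType) (r : gT -> K)
    (L : {group gT}) :
  (forall a, 0 <= r a) ->
  (forall g, convpow r m g @[m --> \oo] --> ((g \in L)%:R / #|L|%:R : K)) ->
  forall a, 0 < r a -> a \in L.
Proof.
move=> r0 cq a ra; apply: contraT => aL.
have cardL : (0 < #|L|%:R :> K) by rewrite ltr0n cardG_gt0.
have c1 := cq a; rewrite (negPf aL) mul0r in c1.
have c2 : r a * convpow r m 1%g @[m --> \oo] --> r a * (1 / #|L|%:R).
  by apply: cvgMr; have := cq 1%g; rewrite group1.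
have c1' : convpow r m.+1 a @[m --> \oo] --> (0 : K).
  by rewrite -(@cvg_shiftS K) in c1.
have := ler_cvg_to c2 c1' _.
rewrite leNgt mulr_gt0 ?divr_gt0//=; apply.
near=> m; rewrite [leRHS]/= (bigD1 a)//= mulVg lerDl.
by apply: sumr_ge0 => b _; rewrite mulr_ge0// convpow_ge0.
Unshelve. all: by end_near. Qed.

(** If [r] were carried by [x *: H], its powers whose exponent is a multiple of
    [#|L|] would be carried by [H], hence vanish at any [g] in [L] outside of
    [H], where the limit is positive. *)
Lemma cvg_convpow_aperiodic (K : realType) (gT : finGroupType) (r : gT -> K)
    (L : {group gT}) :
  abelian L -> (forall a, 0 <= r a) ->
  (forall g, convpow r m g @[m --> \oo] --> ((g \in L)%:R / #|L|%:R : K)) ->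
  forall (H : {group gT}) x, H \proper L -> x \in L ->
  exists2 a, 0 < r a & (x^-1 * a)%g \notin H.
Proof.
move=> abL r0 cq H x /properP[HL [g gL gH]] xL.
apply: contrapT => nex.
have rH a : 0 < r a -> (x^-1 * a)%g \in H.
  by move=> ra; apply: contrapT => /negP naH; apply: nex; exists a.
have cardL : (0 < #|L|%:R :> K) by rewrite ltr0n cardG_gt0.
have c0 := cq g; rewrite gL in c0.
have : (1 / #|L|%:R : K) = 0.
  apply: (cvg_unique _ _
    (_ : convpow r (m * #|L|)%N g @[m --> \oo] --> (0 : K))) => //.
    apply: (cvg_comp (fun m => m * #|L|)%N (fun m => convpow r m g) _ c0).
    exact: cvg_mulnr.
  rewrite (_ : (fun m => _) = cst 0); first exact: cvg_cst.
  apply/funext => m /=; apply/eqP; rewrite eq_le convpow_ge0// andbT leNgt.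
  apply: contra gH => /(convpow_coset abL xL HL r0 rH).
  by rewrite mulnC expgM expg_cardG// expg1n invg1 mul1g.
by apply/eqP; rewrite gt_eqF// divr_gt0.
Qed.

(** * Variables with values in the natural numbers *)

Lemma measurable_nat_preimage d (T : measurableType d) (Z : T -> nat) A :
  measurable_fun setT Z -> measurable (Z @^-1` A).
Proof. by move=> mZ; rewrite -[_ @^-1` _]setTI; apply: mZ. Qed.
Arguments measurable_nat_preimage {d T Z} A.

Lemma measurable_fun_sumn d (T : measurableType d) (Z : nat -> T -> nat) m :
  (forall i, measurable_fun setT (Z i)) ->
  measurable_fun setT (fun t => \sum_(i < m) Z i t)%N.
Proof.
move=> mZ; elim: m => [|m IH].
  by under eq_fun do rewrite big_ord0; apply: measurable_cst.
by under eq_fun do rewrite big_ord_recr /=; apply: measurable_fun_addn.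
Qed.

Lemma prob1_setI (K : realType) d (T : measurableType d) (P : probability T K)
    (E B : set T) :
  measurable E -> measurable B -> P B = 1%E -> P (E `&` B) = P E.
Proof.
move=> mE mB PB.
have PBC : P (~` B) = 0%E by rewrite probability_setC// PB subee.
rewrite -[in RHS](setUIDK E B) measureU//; last 3 first.
- exact: measurableI.
- exact: measurableD.
- by rewrite setDE setIACA setICr setI0.
rewrite [X in (_ + X)%E](_ : _ = 0%E) ?adde0//.
apply: (subset_measure0 _ _ _ PBC); [exact: measurableD|exact: measurableC|].
by move=> t [].
Qed.

(** The partition formula for a variable that is almost surely below [N]. *)
Lemma prob_split (K : realType) d (T : measurableType d) (P : probability T K)
    (Z : T -> nat) N (E : set T) (A : set nat) :
  measurable_fun setT Z -> P (Z @^-1` `I_N) = 1%E -> measurable E ->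
  P (E `&` Z @^-1` A) =
  (\sum_(j < N | (j : nat) \in A) P (E `&` Z @^-1` [set (j : nat)]))%E.
Proof.
move=> mZ PZ mE; have mZp := measurable_nat_preimage ^~ mZ.
have mEA B : measurable (E `&` Z @^-1` B) by apply: measurableI.
rewrite -(prob1_setI (mEA A) (mZp _) PZ).
rewrite -measure_bigsetU_ord_cond//; last first.
  move=> i j _ _ [t [[_ ti] [_ tj]]].
  by apply: val_inj; rewrite /= -[LHS]ti -[RHS]tj.
pose F j := if j \in A then E `&` Z @^-1` [set j] else set0.
have -> : \big[setU/set0]_(j < N | (j : nat) \in A)
    (E `&` Z @^-1` [set (j : nat)]) = \bigcup_(j < N) F j.
  by rewrite bigcup_mkord big_mkcond.
congr (P _); apply/seteqP; split=> [t [[Et At] ZN]|t [j /= jN]].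
  by exists (Z t) => //=; rewrite /F mem_set.
rewrite /F; case: ifPn => // /set_mem jA [Et /= Zj].
by split; rewrite /preimage/= ?Zj.
Qed.

Section independence.
Variables (K : realType) (d : measure_display) (T : measurableType d).
Variables (P : probability T K) (Xs : nat -> {RV P >-> nat}).

Lemma independent_RVs_prefix n (A : nat -> set nat) :
  independent_RVs Xs ->
  P (\bigcap_(i in `I_n) (Xs i @^-1` A i)) =
  (\prod_(i < n) P (Xs i @^-1` A i))%E.
Proof.
move=> indX; rewrite -[X in \bigcap_(i in X) _](fset_setK (finite_II n)).
rewrite indX//.
by rewrite (fsbig_ord _ _ (fun i => P (Xs i @^-1` A i))) fsbig_finite.
Qed.

(** Independence need only be tested on the initial segments of the family. *)
Lemma prefix_independent_RVs :
  (forall n (A : nat -> set nat),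
    P (\bigcap_(i in `I_n) (Xs i @^-1` A i)) =
    (\prod_(i < n) P (Xs i @^-1` A i))%E) ->
  independent_RVs Xs.
Proof.
move=> H J A _.
pose n := (\max_(i <- J) i).+1.
have Jn i : i \in J -> (i < n)%N.
  by move=> iJ; rewrite ltnS; apply: leq_bigmax_seq.
pose A' i := if i \in J then A i else setT.
have -> : \bigcap_(i in [set` J]) (Xs i @^-1` A i)
    = \bigcap_(i in `I_n) (Xs i @^-1` A' i).
  apply/seteqP; split=> t HA i /= iJ.
    by rewrite /A'; case: ifPn => // iJ'; apply: HA.
  by have := HA i (Jn _ iJ); rewrite /= /A' iJ.
rewrite H (fsbig_ord _ _ (fun i => P (Xs i @^-1` A' i))).
rewrite [RHS]fsbig_seq; last exact: fset_uniq.
rewrite -(fsbig_widen [set` J] `I_n) => [|i|i] /=.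
- by apply: eq_fsbigr => i /set_mem /= iJ; rewrite /A' iJ.
- exact: Jn.
- move=> [_ /= /negP/negPf niJ]; rewrite /A' niJ.
  by rewrite preimage_setT probability_setT.
Qed.

End independence.

(** * The law of a sum of independent variables modulo [n.+1] *)

Section sum_law.
Variables (K : realType) (d : measure_display) (T : measurableType d).
Variables (P : probability T K) (Xs : nat -> {RV P >-> nat}).
Variables (n : nat) (p : 'I_n.+1 -> K).
Hypothesis Xs_indep : independent_RVs Xs.
Hypothesis Xs_lt : forall i, P (Xs i @^-1` `I_n.+1) = 1%E.
Hypothesis Xs_law : forall i (k : 'I_n.+1),
  P (Xs i @^-1` [set (k : nat)]) = (p k)%:E.

Let S m t : 'I_n.+1 := inZp (\sum_(i < m) Xs i t).

Let measurable_S m k : measurable [set t | S m t = k].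
Proof.
have mX : measurable_fun setT (fun t => \sum_(i < m) Xs i t)%N.
  by apply: (@measurable_fun_sumn _ _ (fun i => Xs i : T -> nat)) => i.
exact: (measurable_nat_preimage [set s | inZp s = k] mX).
Qed.

(** A partial sum is independent of the variables of larger indices. The
    latter have to be kept in the induction on [m]. *)
Lemma prob_sum_and_tail m l (A : nat -> set nat) k :
  P ([set t | S m t = k] `&`
     \bigcap_(i in [set i | m <= i < m + l]%N) (Xs i @^-1` A i)) =
  ((convpow p m k)%:E * \prod_(m <= i < m + l) P (Xs i @^-1` A i))%E.
Proof.
elim: m l A k => [|m IH] l A k.
  rewrite add0n /= big_mkord -(independent_RVs_prefix _ _ Xs_indep).
  have S0 t : S 0 t = 0 by apply: val_inj; rewrite /= big_ord0 mod0n.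
  have [->|k0] := eqVneq k 1%g.
    rewrite (_ : [set t | _] = setT) ?setTI ?mul1e//.
    by apply/seteqP; split => // t _; rewrite /= S0.
  rewrite mul0e (_ : [set t | _] = set0) ?set0I ?measure0//.
  apply/seteqP; split => // t /= /esym kE; move: k0.
  by rewrite kE S0 eqxx.
set E := (_ `&` _).
have mE : measurable E.
  apply: measurableI => //; apply: bigcap_measurableType => i _.
  exact: measurable_funPTI.
rewrite -[E]setIT -[in LHS](preimage_setT (Xs m)).
rewrite (prob_split _ _ (Xs_lt m))//.
rewrite (eq_bigl xpredT) => [|j]; last by rewrite in_setT.
(* Given [Xs m = j], the event on [S m.+1] is one on [S m], to which the
   induction hypothesis applies with the tail event extended by [Xs m = j]. *)
pose A' (j : 'I_n.+1) i := if i == m then [set (j : nat)] else A i.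
transitivity (\sum_(j < n.+1) (((convpow p m (j^-1 * k)%g)%:E *
    \prod_(m <= i < m + l.+1) P (Xs i @^-1` A' j i)))%E).
  apply: eq_bigr => j _; rewrite -IH; congr (P _).
  have Sm t : Xs m t = j -> (S m t = (j^-1 * k)%g) <-> (S m.+1 t = k).
    move=> Xj.
    have -> : S m.+1 t = (j * S m t)%g.
      apply: val_inj.
      by rewrite /= big_ord_recr/= Xj modnDmr addnC.
    by split=> [->|<-]; rewrite ?mulKVg ?mulKg.
  rewrite /E; apply/seteqP; split=> t.
    case=> -[/= Sk tl] /= Xj; split; first exact/(Sm t Xj).
    move=> i /= /andP[mi il]; rewrite /A'; case: eqP => [->//|/eqP im].
    by apply: tl; rewrite /= ltn_neqAle eq_sym im mi addSnnS.
  case=> /= Sk tl.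
  have Xj : Xs m t = j.
    have := tl m; rewrite /= /A' eqxx; apply.
    by rewrite leqnn addnS ltnS leq_addr.
  split=> //; split; first exact/(Sm t Xj).
  move=> i /= /andP[mi il].
  have := tl i; rewrite /= /A' gtn_eqF//; apply.
  by rewrite ltnW// addnS -addSn.
transitivity (\sum_(j < n.+1) (((p j * convpow p m (j^-1 * k)%g)%:E *
    \prod_(m.+1 <= i < m.+1 + l) P (Xs i @^-1` A i)))%E).
  apply: eq_bigr => j _; rewrite big_ltn ?addnS ?ltnS ?leq_addr//.
  rewrite {1}/A' eqxx Xs_law mulrC EFinM !muleA; congr (_ * _)%E.
  by apply: eq_big_nat => i /andP[mi _]; rewrite /A' gtn_eqF.
rewrite -ge0_sume_distrl//.
  by rewrite sumEFin.
have p0 i : 0 <= p i by rewrite -lee_fin -(Xs_law 0).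
by move=> j _; rewrite lee_fin; apply: mulr_ge0 => //; exact: convpow_ge0.
Qed.

Lemma prob_sum m (k : 'I_n.+1) :
  P [set t | ((\sum_(i < m) Xs i t) %% n.+1)%N = k] = (convpow p m k)%:E.
Proof.
have := prob_sum_and_tail m 0 (fun=> setT) k.
rewrite addn0 big_geq// mule1 => <-; congr (P _).
rewrite [X in _ `&` X](_ : _ = setT) ?setIT; last first.
  by apply/seteqP; split => // t _ i /=; rewrite preimage_setT.
by apply/seteqP; split=> t /=; [move=> E; apply: val_inj; exact: E | move=> <-].
Qed.

End sum_law.

Lemma big_addmod N (I : Type) (s : seq I) (F : I -> nat) :
  (0 < N)%N -> (\big[addmod N/0%N]_(i <- s) F i = (\sum_(i <- s) F i) %% N)%N.
Proof.
move=> N0; elim/big_rec2: _ => [|i y x _ ->]; first by rewrite mod0n.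
by rewrite /addmod modnDmr.
Qed.

(** * Existence of independent copies *)

(** The Lebesgue measure on [[0, 1[]. *)
Definition unit_lebesgue (K : realType) :=
  mrestr (@lebesgue_measure K) (measurable_itv `[0, 1[).
Arguments unit_lebesgue K : clear implicits.

HB.instance Definition _ (K : realType) := Measure.on (unit_lebesgue K).

Lemma unit_lebesgue_setT (K : realType) : unit_lebesgue K setT = 1%E.
Proof.
rewrite /unit_lebesgue /mrestr setTI lebesgue_measure_itv/= lte_fin ltr01.
by rewrite sube0.
Qed.

HB.instance Definition _ (K : realType) :=
  Measure_isProbability.Build _ _ _ (unit_lebesgue K) (unit_lebesgue_setT K).

Section iid.
Variables (K : realType) (p : nat -> K) (N : nat).
Hypothesis p_ge0 : forall k, 0 <= p k.
Hypothesis p_sum1 : \sum_(k < N) p k = 1.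

Let c k := \sum_(j < k) p j.

Let cS k : c k.+1 = c k + p k. Proof. by rewrite /c big_ord_recr. Qed.

Let c_homo j k : (j <= k)%N -> c j <= c k.
Proof.
move=> /subnKC <-; elim: (k - j)%N => [|i IH]; first by rewrite addn0.
by rewrite addnS cS ler_wpDr.
Qed.

(** For [x] in [[0, 1[], [digit x] is the index [k < N] of the interval
    [[c k, c k.+1[] that contains [x], counted as the number of right endpoints
    [c k.+1] that are at most [x]; [shift] maps each nonempty interval among
    these affinely onto [[0, 1[]. *)
Definition digit (x : K) : nat := (\sum_(k < N) (c k.+1 <= x)%R)%N.

Definition shift (x : K) : K := (x - c (digit x)) / p (digit x).

(** The [i]-th digit of the expansion of [x]. *)
Definition nth_digit i (x : K) : nat := digit (iter i shift x).

Lemma digit_eq k x : (k < N)%N -> c k <= x < c k.+1 -> digit x = k.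
Proof.
move=> kN /andP[kx xk]; rewrite /digit.
transitivity (\sum_(j < N) (j < k)%N)%N.
  apply: eq_bigr => j _; congr nat_of_bool.
  have [jk|kj] := ltnP j k; first by apply: le_trans kx; apply: c_homo.
  by apply/negbTE; rewrite -ltNge; apply: (lt_le_trans xk); apply: c_homo.
rewrite (eq_bigr (fun j : 'I_N => if (j < k)%N then 1 else 0)%N); last first.
  by move=> j _; case: ltnP.
rewrite -big_mkcond (big_ord_narrow (ltnW kN)).
by rewrite sum1_card card_ord.
Qed.

Lemma digitP x : 0 <= x < 1 ->
  (digit x < N)%N /\ c (digit x) <= x < c (digit x).+1.
Proof.
move=> /andP[x0 x1].
have ex : exists j, x < c j by exists N; rewrite /c p_sum1.
have [[|k] xk kmin] := ex_minnP ex.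
  by move: xk; rewrite /c big_ord0 ltNge x0.
have kN : (k < N)%N by apply: kmin; rewrite /c p_sum1.
have kx : c k <= x by rewrite leNgt; apply/negP => /kmin; rewrite ltnn.
have xkk : c k <= x < c k.+1 by rewrite kx.
by rewrite (digit_eq kN xkk).
Qed.

Lemma shift_itv x : 0 <= x < 1 -> 0 <= shift x < 1.
Proof.
move=> /digitP[_]; rewrite cS /shift; set k := digit x => /andP[kx xk].
have pk : 0 < p k by lra.
by rewrite divr_ge0 ?subr_ge0//= ltr_pdivrMr// mul1r ltrBlDl.
Qed.

Lemma iter_shift_itv i x : 0 <= x < 1 -> 0 <= iter i shift x < 1.
Proof. by move=> x01; elim: i => //= i; apply: shift_itv. Qed.

Lemma measurable_digit : measurable_fun setT digit.
Proof.
apply: (@measurable_fun_sumn _ _ (fun k x => (c k.+1 <= x)%R : nat) N) => k.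
apply: (@measurableT_comp _ _ _ _ _ _ nat_of_bool) => //.
exact: measurable_fun_ler.
Qed.

Lemma measurable_shift : measurable_fun setT shift.
Proof.
have mf (f : nat -> K) : measurable_fun setT (fun x => f (digit x)).
  by apply: (@measurableT_comp _ _ _ _ _ _ f) => //; exact: measurable_digit.
apply: measurable_funM; last exact: (mf (fun k => (p k)^-1)).
by apply: measurable_funB => //; exact: mf.
Qed.

Lemma measurable_nth_digit i : measurable_fun setT (nth_digit i).
Proof.
apply: (@measurableT_comp _ _ _ _ _ _ digit); first exact: measurable_digit.
elim: i => [|i IH] /=; first exact: measurable_id.
exact: (measurableT_comp measurable_shift IH).
Qed.

(** The [i]-th digit as a random variable under the Lebesgue measure. *)
Definition iid_copy i : {RV (unit_lebesgue K) >-> nat} :=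
  @mfun_Sub _ _ (measurableTypeR K) nat (nth_digit i)
    (mem_set (measurable_nth_digit i)).

(** The points of [[0, 1[] whose expansion starts with the word [w] form the
    interval of origin [word_left w] and of length [word_mass w]. *)
Fixpoint word_left (w : seq nat) : K :=
  if w is k :: w' then c k + p k * word_left w' else 0.

Definition word_mass (w : seq nat) : K := \prod_(k <- w) p k.

Definition word_set (w : seq nat) : set K :=
  [set x | 0 <= x < 1 /\
    forall i, (i < size w)%N -> nth_digit i x = nth 0%N w i].

(** The bounds on the interval are what the induction needs: when a digit [k] is
    put in front, they keep the interval inside [[c k, c k.+1[]. *)
Lemma word_itv w : all (fun k => k < N)%N w ->
  [/\ 0 <= word_left w, word_left w + word_mass w <= 1 &
      forall x, word_set w x <->
        word_left w <= x < word_left w + word_mass w].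
Proof.
elim: w => [_|k w IH /= /andP[kN /IH[l0 l1 lE]]].
  by rewrite /= /word_mass big_nil add0r; split=> // x; split=> [[]//|?]; split.
have m0 : 0 <= word_mass w by apply: prodr_ge0.
have mE : word_mass (k :: w) = p k * word_mass w by rewrite /word_mass big_cons.
have ck0 : 0 <= c k by apply: sumr_ge0.
have ck1 : c k + p k <= 1 by rewrite -cS -p_sum1; apply: c_homo.
have pk0 := p_ge0 k.
rewrite mE; split; [by rewrite addr_ge0// mulr_ge0| |move=> x].
  rewrite -addrA -mulrDr; apply: le_trans ck1; rewrite lerD2l.
  by rewrite ler_piMr.
have -> : word_set (k :: w) x <->
    c k <= x < c k + p k /\ word_set w ((x - c k) / p k).
  split=> [[x01 xw]|[/andP[kx xk] [y01 yw]]].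
    have /= Dk := xw 0%N isT; rewrite /nth_digit/= in Dk.
    have [_] := digitP x01; rewrite Dk cS => ckx; split=> //.
    have Sx : shift x = (x - c k) / p k by rewrite /shift Dk.
    rewrite -Sx; split; first exact: shift_itv.
    by move=> i iw; have := xw i.+1 iw; rewrite /nth_digit iterSr.
  have Dk : digit x = k by apply: digit_eq => //; rewrite cS kx.
  have Sx : shift x = (x - c k) / p k by rewrite /shift Dk.
  split; first by apply/andP; split; lra.
  case=> [_|i iw]; first by rewrite /nth_digit.
  by rewrite /nth_digit iterSr Sx; apply: yw.
have [p0|p0] := eqVneq (p k) 0.
  rewrite p0 !mul0r !addr0; split=> [[]|]; first by [].
  by case/andP=> a b; have := le_lt_trans a b; rewrite ltxx.
have pk : 0 < p k by rewrite lt_neqAle eq_sym p0.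
rewrite lE ler_pdivlMr// ltr_pdivrMr//.
have B1 : 0 <= word_left w * p k by rewrite mulr_ge0.
have B2 : (word_left w + word_mass w) * p k <= p k by rewrite ler_piMl.
split=> [[/andP[h1 h2] /andP[h3 h4]]|/andP[h3 h4]].
  by apply/andP; split; lra.
by split; apply/andP; split; lra.
Qed.

Lemma word_setE w : all (fun k => k < N)%N w ->
  word_set w = [set` `[word_left w, word_left w + word_mass w[].
Proof.
move=> /word_itv[_ _ lE].
by apply/seteqP; split=> x /=; rewrite in_itv/=; apply lE.
Qed.

Lemma measurable_word_set w : all (fun k => k < N)%N w ->
  measurable (word_set w : set (measurableTypeR K)).
Proof. by move=> /word_setE ->; exact: measurable_itv. Qed.

Lemma unit_lebesgue_word w : all (fun k => k < N)%N w ->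
  unit_lebesgue K (word_set w) = (word_mass w)%:E.
Proof.
move=> wN; have [l0 l1 lE] := word_itv wN.
have m0 : 0 <= word_mass w by apply: prodr_ge0.
rewrite /unit_lebesgue /mrestr.
have -> : word_set w `&` [set` `[0, 1[]
    = [set` `[word_left w, word_left w + word_mass w[].
  apply/seteqP; split=> x /=; rewrite !in_itv/=; first by case=> /lE.
  by move=> /lE xw; split => //; case: xw.
rewrite lebesgue_measure_itv/= lte_fin -[X in X < _]addr0 ltrD2l.
have [mp|mn] := ltP 0 (word_mass w).
  by rewrite -EFinD addrAC subrr add0r.
by congr EFin; apply/eqP; rewrite eq_le m0.
Qed.

Lemma iid_copy_lt i : unit_lebesgue K (iid_copy i @^-1` `I_N) = 1%E.
Proof.
rewrite -(unit_lebesgue_setT K) /unit_lebesgue /mrestr; congr lebesgue_measure.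
apply/seteqP; split=> x [_] //= x01; split => //=.
apply: (proj1 (digitP _)); apply: iter_shift_itv.
by move: x01; rewrite in_itv.
Qed.

(** The first digits, fixed to those of [w], are independent of the next [l]
    ones; the induction on [l] lengthens [w] by one digit. *)
Lemma prob_word_and_tail w l (A : nat -> set nat) :
  all (fun k => k < N)%N w ->
  unit_lebesgue K (word_set w `&` \bigcap_(i in
      [set i | size w <= i < size w + l]%N) (iid_copy i @^-1` A i)) =
  (word_mass w *
    \prod_(i < l) \sum_(j < N | (j : nat) \in A (size w + i)%N) p j)%:E.
Proof.
elim: l w => [|l IH] w wN.
  rewrite big_ord0 mulr1 -unit_lebesgue_word// addn0.
  congr (unit_lebesgue K _); rewrite -[RHS]setIT; congr (_ `&` _).
  apply/seteqP; split => // t _ i /= /andP[a b].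
  by have := leq_ltn_trans a b; rewrite ltnn.
set n := size w.
set E := word_set w `&` \bigcap_(i in [set i | n < i < n + l.+1]%N)
  (iid_copy i @^-1` A i).
have mX i B : measurable (iid_copy i @^-1` B) by exact: measurable_funPTI.
have mE : measurable E.
  apply: measurableI; first exact: measurable_word_set.
  by apply: bigcap_measurableType => i _; exact: mX.
transitivity (unit_lebesgue K (E `&` iid_copy n @^-1` A n)).
  congr (unit_lebesgue K _); rewrite /E -setIA; congr (_ `&` _).
  apply/seteqP; split=> t.
    move=> tA; split; last by apply: tA; rewrite /= leqnn addnS ltnS leq_addr.
    by move=> i /= /andP[ni il]; apply: tA; rewrite /= ltnW.
  case=> tl tn i /= /andP[]; rewrite leq_eqVlt => /orP[/eqP<-//|ni il].
  by apply: tl; rewrite /= ni.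
rewrite (prob_split _ _ (iid_copy_lt n))//.
transitivity (\sum_(j < N | (j : nat) \in A n) ((p j * (word_mass w *
    \prod_(i < l) \sum_(j < N | (j : nat) \in A (n.+1 + i)%N) p j))%:E))%E;
    last first.
  rewrite sumEFin -mulr_suml big_ord_recl addn0 mulrCA; congr (_ * (_ * _))%:E.
  by apply: eq_bigr => i _; rewrite /= /bump add1n addSnnS.
apply: eq_bigr => j _.
have wjN : all (fun k => k < N)%N (rcons w j) by rewrite all_rcons wN ltn_ord.
apply: (etrans _ (etrans (IH _ wjN) _)).
  congr (unit_lebesgue K _).
  rewrite size_rcons /E addnS -addSn setIAC; congr (_ `&` _).
  apply/seteqP; split=> t.
    case=> -[t01 tw] Xj; split=> // i; rewrite size_rcons nth_rcons ltnS.
    rewrite leq_eqVlt => /orP[/eqP->|iw]; last by rewrite iw tw.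
    by rewrite ltnn eqxx.
  case=> t01 tw; split.
    split=> // i iw; have := tw i.
    by rewrite size_rcons nth_rcons iw; apply; rewrite ltnW.
  by have := tw n; rewrite size_rcons nth_rcons ltnn eqxx; apply.
rewrite size_rcons; congr EFin.
by rewrite /word_mass -cats1 big_cat big_seq1/= [LHS]mulrAC [LHS]mulrC.
Qed.

Lemma prefix_iid_copy n (A : nat -> set nat) :
  unit_lebesgue K (\bigcap_(i in `I_n) (iid_copy i @^-1` A i)) =
  (\prod_(i < n) \sum_(j < N | (j : nat) \in A i) p j)%:E.
Proof.
have := @prob_word_and_tail [::] n A isT.
rewrite /word_mass big_nil mul1r /= => <-.
rewrite setIC prob1_setI//.
- by apply: bigcap_measurableType => i _; exact: (measurable_funPTI (iid_copy i)).
- exact: measurable_word_set.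
- by apply: etrans (unit_lebesgue_word _) _; rewrite // /word_mass big_nil.
Qed.

Lemma iid_copy_law i (A : set nat) :
  unit_lebesgue K (iid_copy i @^-1` A) =
  (\sum_(j < N | (j : nat) \in A) p j)%:E.
Proof.
pose A' j := if j == i then A else setT.
have := prefix_iid_copy i.+1 A'.
have A'i : A' i = A by rewrite /A' eqxx.
rewrite big_ord_recr/= A'i big1 ?mul1r => [<-|j _].
  congr (unit_lebesgue K _); apply/seteqP; split=> t /=.
    by move=> tA j /= ji; rewrite /A'; case: eqP => // ->.
  by move=> /(_ i (ltnSn i)) /=; rewrite /A' eqxx.
rewrite -p_sum1; apply: eq_bigl => k.
by rewrite /A' ltn_eqF// in_setT.
Qed.

Lemma iid_copy_independent : independent_RVs iid_copy.
Proof.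
apply: prefix_independent_RVs => n A.
apply: etrans (prefix_iid_copy n A) _; rewrite -prodEFin.
by apply: eq_bigr => i _; exact/esym/iid_copy_law.
Qed.

End iid.

(** * Convergence in distribution of bounded natural variables *)

Lemma expectation_nat (K : realType) d (T : measurableType d)
    (P : probability T K) (Z : T -> nat) N (f : nat -> K) :
  measurable_fun setT Z -> P (Z @^-1` `I_N) = 1%E ->
  ('E_P[f \o Z] = \sum_(k < N) (f k)%:E * P (Z @^-1` [set (k : nat)]))%E.
Proof.
move=> mZ PZ; rewrite unlock.
have mZp A : measurable (Z @^-1` A) by exact: measurable_nat_preimage.
have mI (k : nat) : measurable_fun setT
    (fun t => (f k)%:E * (\1_(Z @^-1` [set k]) t)%:E)%E.
  by apply: measurable_funeM; apply/measurable_EFinP; exact: measurable_indic.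
have iI (k : 'I_N) : P.-integrable setT (EFin \o \1_(Z @^-1` [set (k : nat)])).
  by apply: integrable_indic => //; rewrite setIT -ge0_fin_numE ?fin_num_measure.
rewrite (ae_eq_integral (fun t =>
    \sum_(k < N) (f k)%:E * (\1_(Z @^-1` [set (k : nat)]) t)%:E)%E)//.
- rewrite integral_sum//; last by move=> k; apply: integrableZl => //; exact: iI.
  apply: eq_bigr => k _; rewrite integralZl//; last exact: iI.
  by rewrite integral_indic// setIT.
- apply/measurable_EFinP; exact: measurableT_comp.
- by apply: emeasurable_sum => k; exact: mI.
exists (~` (Z @^-1` `I_N)); split.
- exact: measurableC.
- by apply: etrans (probability_setC _ (mZp _)) _; rewrite PZ subee.
- apply: subsetC => t /= ZtN _.
  rewrite (bigD1 (Ordinal ZtN))//= big1 => [|k kZ].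
    by rewrite indicE mem_set// mule1 adde0.
  rewrite indicE memNset ?mule0// => /= Zk; move/eqP: kZ; apply.
  exact/val_inj.
Qed.

(** For variables almost surely below [N], convergence in distribution is
    convergence of the probability mass functions. *)
Lemma cvg_in_distribution_nat (K : realType) N
    d (T : measurableType d) (P : probability T K) (Z : nat -> T -> nat)
    d' (T' : measurableType d') (P' : probability T' K) (xi : T' -> nat)
    (a : nat -> 'I_N -> K) (b : 'I_N -> K) :
  (forall m, measurable_fun setT (Z m)) ->
  (forall m, P (Z m @^-1` `I_N) = 1%E) ->
  (forall m (k : 'I_N), P (Z m @^-1` [set (k : nat)]) = (a m k)%:E) ->
  measurable_fun setT xi -> P' (xi @^-1` `I_N) = 1%E ->
  (forall k : 'I_N, P' (xi @^-1` [set (k : nat)]) = (b k)%:E) ->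
  cvg_in_distribution P Z P' xi <->
  (forall k, a m k @[m --> \oo] --> b k).
Proof.
move=> mZ ZN Za mxi xiN xib.
have EZ f m : ('E_P[f \o Z m] = (\sum_(k < N) f k * a m k)%:E)%E.
  rewrite (expectation_nat _ (mZ m) (ZN m)) -sumEFin.
  by apply: eq_bigr => k _; rewrite Za.
have Exi f : ('E_P'[f \o xi] = (\sum_(k < N) f k * b k)%:E)%E.
  rewrite (expectation_nat _ mxi xiN) -sumEFin.
  by apply: eq_bigr => k _; rewrite xib.
split=> [cvgZ k|cvga f _ _].
  pose f (s : nat) : K := (s == k)%:R.
  have sumf (h : 'I_N -> K) : \sum_(j < N) f j * h j = h k.
    rewrite (bigD1 k)//= /f eqxx mul1r big1 ?addr0// => j jk.
    by rewrite (inj_eq val_inj) (negPf jk) mul0r.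
  have fc : continuous f.
    by move=> s A /nbhs_singleton As; apply/principal_filterP.
  have fb : exists B : K, forall s, `|f s| <= B.
    by exists 1 => s; rewrite /f; case: eqP; rewrite ?normr1 ?normr0.
  have := cvgZ f fc fb; rewrite Exi sumf.
  under eq_fun do rewrite EZ sumf.
  by move/fine_cvg.
rewrite Exi; under eq_fun do rewrite EZ.
apply: cvg_EFin; first by apply: nearW.
apply: cvg_big => [|k _]; first exact: add_continuous.
by apply: cvgMr; exact: cvga.
Qed.

(** * Translation to residues modulo [n.+1] *)

(** The residues modulo [n.+1] that are multiples of [M]; they form a subgroup
    when [M] divides [n.+1]. *)
Definition multiples n M : {set 'I_n.+1} := [set g : 'I_n.+1 | (M %| g)%N].

Lemma group_set_multiples n M : (M %| n.+1)%N -> group_set (multiples n M).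
Proof.
move=> Mn; apply/group_setP; split; first by rewrite inE dvdn0.
move=> x y; rewrite !inE => Mx My.
change (M %| (x + y) %% n.+1)%N.
have := dvdn_add Mx My; rewrite {1}(divn_eq (x + y) n.+1).
by rewrite dvdn_addr// dvdn_mull.
Qed.

Definition multiples_group n M (Mn : (M %| n.+1)%N) : {group 'I_n.+1} :=
  Group (group_set_multiples Mn).

Lemma card_multiples n M R : n.+1 = (M * R)%N -> #|multiples n M| = R.
Proof.
move=> nMR; have M0 : (0 < M)%N by case: M nMR.
have lt (j : 'I_R) : (M * j < n.+1)%N by rewrite nMR ltn_pmul2l.
pose h j : 'I_n.+1 := Ordinal (lt j).
have -> : multiples n M = [set h j | j in 'I_R]%SET.
  apply/setP => g; rewrite inE; apply/idP/imsetP => [/dvdnP[j gj]|[j _ ->]].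
    have jR : (j < R)%N.
      by rewrite -(ltn_pmul2l M0) -nMR mulnC -gj.
    by exists (Ordinal jR) => //; apply: val_inj; rewrite /= gj mulnC.
  by rewrite /= dvdn_mulr.
rewrite card_imset ?card_ord// => i j [] /eqP.
by rewrite eqn_pmul2l// => /eqP /val_inj.
Qed.

(** In the group of residues, [(x^-1 * g) ^+ t] is the class of
    [(g - x) * t = M * (y - a) * t] modulo [M * R]. *)
Lemma multiples_expg_eq1 n M R (g x : 'I_n.+1) (y a t : nat) :
  n.+1 = (M * R)%N -> (g : nat) = (M * y)%N -> (x : nat) = (M * a)%N ->
  (((x^-1 * g) ^+ t)%g = 1%g) <->
  ((y%:Z - a%:Z) * t%:Z %% R%:Z)%Z = 0.
Proof.
move=> nMR gy xa.
have M0 : M%:Z != 0 by rewrite eqz_nat; case: M nMR {gy xa}.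
have xn : (x <= n.+1)%N := ltnW (ltn_ord x).
have -> : ((x^-1 * g) ^+ t)%g = 1%g <-> (n.+1 %| (n.+1 - x + g) * t)%N.
  rewrite Zp_expg.
  have E : (val (inZp ((x^-1 * g)%g * t) : 'I_n.+1)
      = ((n.+1 - x + g) * t) %% n.+1)%N.
    change ((((n.+1 - x) %% n.+1 + g) %% n.+1 * t) %% n.+1
      = ((n.+1 - x + g) * t) %% n.+1)%N.
    by rewrite modnMml -modnMml modnDml modnMml.
  split=> [/(congr1 val)|h].
    by rewrite E /= => /eqP.
  by apply: val_inj; rewrite E; apply/eqP.
have -> : (n.+1 %| (n.+1 - x + g) * t)%N = (R%:Z %| (y%:Z - a%:Z) * t%:Z)%Z.
  rewrite -[LHS]/(n.+1%:Z %| ((n.+1 - x + g) * t)%N%:Z)%Z.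
  rewrite PoszM PoszD -subzn// gy xa.
  have -> : (n.+1%:Z - (M * a)%N%:Z + (M * y)%N%:Z) * t%:Z
      = M%:Z * ((y%:Z - a%:Z) * t%:Z) + t%:Z * n.+1%:Z.
    rewrite !PoszM; ring.
  rewrite rpredDr; last by rewrite /= dvdz_mull.
  by rewrite nMR PoszM dvdz_mul2l.
split=> [/dvdz_mod0P//|h]; exact/dvdz_mod0P.
Qed.

Lemma ae_witness (K : realType) d (T : measurableType d) (P : probability T K)
    (A : set T) (Q : T -> Prop) :
  measurable A -> (0 < P A)%E -> {ae P, forall t, Q t} ->
  exists t, A t /\ Q t.
Proof.
move=> mA PA [B [mB PB QB]]; apply: contrapT => nex.
have AB : A `<=` B.
  by move=> t At; apply: QB => Qt; apply: nex; exists t.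
by move: PA; rewrite (subset_measure0 mA mB AB PB) ltxx.
Qed.

Section law.
Variables (K : realType) (d : measure_display) (T : measurableType d).
Variables (P : probability T K) (X : {RV P >-> nat}) (N : nat).
Hypothesis X_lt : P (X @^-1` `I_N) = 1%E.

(** The probability mass function of [X]. *)
Definition nat_pmf (k : nat) : K := fine (P (X @^-1` [set k])).

Lemma nat_pmfE k : P (X @^-1` [set k]) = (nat_pmf k)%:E.
Proof.
rewrite /nat_pmf fineK//; apply: fin_num_measure; exact: measurable_funPTI.
Qed.

Lemma nat_pmf_ge0 k : 0 <= nat_pmf k.
Proof. by rewrite -lee_fin -nat_pmfE. Qed.

Lemma nat_pmf_sum A :
  P (X @^-1` A) = (\sum_(j < N | (j : nat) \in A) nat_pmf j)%:E.
Proof.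
have mX : measurable_fun setT X by [].
rewrite -[X @^-1` A]setTI (prob_split _ mX X_lt)// -sumEFin.
by apply: eq_bigr => j _; rewrite setTI nat_pmfE.
Qed.

Lemma nat_pmf_sum1 : \sum_(j < N) nat_pmf j = 1.
Proof.
apply: EFin_inj; rewrite -(probability_setT P) -(preimage_setT X) nat_pmf_sum.
by congr EFin; apply: eq_bigl => j; rewrite in_setT.
Qed.

End law.

Section attraction.
Variables (K : realType) (n M R : nat).
Hypothesis nMR : n.+1 = (M * R)%N.
Variables (dU : measure_display) (TU : measurableType dU).
Variables (PU : probability TU K) (U : {RV PU >-> nat}).
Hypothesis U_unif : uniform_below R U.
Variables (d : measure_display) (T : measurableType d) (P : probability T K).
Variables (X : {RV P >-> nat}).
Hypothesis X_lt : P (X @^-1` `I_n.+1) = 1%E.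

Let M_gt0 : (0 < M)%N. Proof. by case: M nMR. Qed.
Let R_gt0 : (0 < R)%N. Proof. by case: R nMR; rewrite // muln0. Qed.

Let p (k : 'I_n.+1) : K := nat_pmf X k.

Lemma uniform_below_lt : PU (U @^-1` `I_R) = 1%E.
Proof.
have -> : U @^-1` `I_R = \bigcup_(j < R) U @^-1` [set j].
  apply/seteqP; split=> [t tR|t [j /= jR Ut]]; first by exists (U t).
  by rewrite /preimage /= Ut.
rewrite bigcup_mkord measure_bigsetU_ord//; last 2 first.
- by move=> j; apply: measurable_funPTI.
- by move=> i j _ _ [t [ti tj]]; apply: val_inj; rewrite /= -[LHS]ti -[RHS]tj.
rewrite (eq_bigr (fun=> (R%:R^-1)%:E)) => [|j _]; last exact: U_unif.
by rewrite sumEFin sumr_const card_ord -[_ *+ R]mulr_natl divff// pnatr_eq0 -lt0n.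
Qed.

Lemma law_mul_uniform (k : 'I_n.+1) :
  PU ((fun w => (M * U w)%N) @^-1` [set (k : nat)]) =
  ((k \in multiples n M)%:R / R%:R)%:E.
Proof.
rewrite inE; have [/dvdnP[j kj]|Mk] := boolP (M %| k)%N.
  have jR : (j < R)%N by rewrite -(ltn_pmul2l M_gt0) -nMR mulnC -kj.
  rewrite mul1r -(U_unif jR); congr (PU _); apply/seteqP; split=> t /=.
    by move=> /eqP; rewrite kj mulnC eqn_pmul2r// => /eqP.
  by move=> ->; rewrite kj mulnC.
rewrite mul0r (_ : _ @^-1` _ = set0) ?measure0//.
apply/seteqP; split=> // t /= E.
by move: Mk; rewrite -E dvdn_mulr.
Qed.

(** The domain of attraction in terms of convolution powers. The copies of [X]
    exist because the law of [X] has finite support. *)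
Lemma in_domain_of_attractionE :
  in_domain_of_attraction n.+1 X PU (fun w => (M * U w)%N) <->
  (forall g, convpow p m g @[m --> \oo] -->
    ((g \in multiples n M)%:R / R%:R : K)).
Proof.
have key d1 (T1 : measurableType d1) (P1 : probability T1 K)
    (Xs : nat -> {RV P1 >-> nat}) : independent_RVs Xs ->
    (forall i (A : set nat), distribution P1 (Xs i) A = distribution P X A) ->
    cvg_in_distribution P1
      (fun m t => \big[addmod n.+1/0%N]_(i < m) Xs i t) PU
      (fun w => (M * U w)%N) <->
    (forall g, convpow p m g @[m --> \oo] -->
      ((g \in multiples n M)%:R / R%:R : K)).
  move=> ind same.
  apply: (@cvg_in_distribution_nat _ n.+1 _ _ _ _ _ _ _ _
    (fun m k => convpow p m k)).
  - move=> m; under eq_fun do rewrite big_addmod//.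
    apply: (@measurableT_comp _ _ _ _ _ _ (fun s => s %% n.+1)%N) => //.
    by apply: (@measurable_fun_sumn _ _ (fun i => Xs i : _ -> nat)).
  - move=> m; rewrite -[RHS](probability_setT P1); congr (P1 _).
    by apply/seteqP; split=> // t _ /=; rewrite big_addmod// ltn_mod.
  - move=> m k; rewrite -(prob_sum ind).
    + congr (P1 _); apply/seteqP; split=> t /=; by rewrite big_addmod.
    + by move=> i; apply: etrans (same i `I_n.+1) X_lt.
    + move=> i j; apply: etrans (same i [set (j : nat)]) _.
      exact: nat_pmfE.
  - by apply: (@measurableT_comp _ _ _ _ _ _ (fun s => M * s)%N).
  - rewrite -uniform_below_lt; congr (PU _); apply/seteqP; split=> t /=.
      by rewrite nMR ltn_pmul2l.
    by rewrite nMR ltn_pmul2l.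
  - exact: law_mul_uniform.
split=> [[d1 [T1 [P1 [Xs [ind same cvg]]]]]|cvg].
  exact/(key _ _ _ _ ind same).
have p0 := nat_pmf_ge0 X; have p1 := nat_pmf_sum1 X_lt.
pose Xs := iid_copy (nat_pmf X) n.+1.
have ind : independent_RVs Xs := iid_copy_independent p0 p1.
have same i A : distribution (unit_lebesgue K) (Xs i) A = distribution P X A.
  apply: etrans (iid_copy_law p0 p1 i A) _.
  exact: (esym (nat_pmf_sum X_lt A)).
exists _, _, (unit_lebesgue K), Xs; split=> //.
exact/(key _ _ _ _ ind same).
Qed.

Lemma multiples_mul (y : nat) : (y < R)%N ->
  exists2 x : 'I_n.+1, (x : nat) = (M * y)%N & x \in multiples n M.
Proof.
move=> yR; have lt : (M * y < n.+1)%N by rewrite nMR ltn_pmul2l.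
by exists (Ordinal lt) => //; rewrite inE dvdn_mulr.
Qed.

(** [Y] is [X %/ M], and a pair [a], [t] is handled with the coset of [M * a]
    modulo the subgroup of all multiples [h] of [M] with [h ^+ t = 1]. *)
Lemma domain_attraction_necessary :
  (forall w, (X w < n.+1)%N) ->
  (forall g, convpow p m g @[m --> \oo] -->
    ((g \in multiples n M)%:R / R%:R : K)) ->
  exists Y : {RV P >-> nat},
    [/\ forall w, (Y w < R)%N,
        {ae P, forall w, X w = (M * Y w)%N} &
        forall a t : nat, (a < R)%N -> (0 < t < R)%N ->
          (P [set w | ((((Y w)%:Z - a%:Z) * t%:Z) %% R%:Z)%Z = 0%R] < 1)%E].
Proof.
move=> Xn cvg.
have Mn : (M %| n.+1)%N by rewrite nMR dvdn_mulr.
pose L := multiples_group Mn.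
have cardL : #|L| = R by rewrite (card_multiples nMR).
have cvgL g : convpow p m g @[m --> \oo] --> ((g \in L)%:R / #|L|%:R : K).
  by rewrite cardL; apply: cvg.
have p0 k : 0 <= p k by apply: nat_pmf_ge0.
have suppL := cvg_convpow_supp p0 cvgL.
have abL : abelian L by apply: FinRing.zmod_abelian.
have aper := cvg_convpow_aperiodic abL p0 cvgL.
have mY : measurable_fun setT (fun w => X w %/ M)%N.
  by apply: (@measurableT_comp _ _ _ _ _ _ (fun s => s %/ M)%N).
pose Y : {RV P >-> nat} := mfun_Sub (mem_set mY).
have YE w : Y w = (X w %/ M)%N by [].
exists Y; split.
- by move=> w; rewrite YE ltn_divLR// mulnC -nMR.
- exists (X @^-1` [set k | ~~ (M %| k)%N]); split.
  + exact: measurable_funPTI.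
  + rewrite (nat_pmf_sum X_lt) big1// => j /set_mem /= Mj.
    apply/eqP; rewrite eq_le nat_pmf_ge0 andbT leNgt.
    by apply: contra Mj => /suppL; rewrite inE.
  + move=> w /=; apply: contra_notN => Mw.
    by rewrite mulnC divnK.
move=> a t aR /andP[t0 tR].
have [x xa xL] := multiples_mul aR.
pose Ht := [set h in L | (h ^+ t)%g == 1%g].
have HtG : group_set Ht.
  apply/group_setP; split; first by apply/setIdP; rewrite group1 expg1n.
  move=> h h' /setIdP[hL /eqP ht] /setIdP[h'L /eqP h't].
  apply/setIdP; split; first exact: groupM.
  by rewrite expgMn ?ht ?h't ?mulg1//; apply: (centsP abL).
have HtL : Group HtG \proper L.
  apply/properP; split; first by apply/fintype.subsetP => h /setIdP[].
  have [e eM eL] := multiples_mul (leq_ltn_trans t0 tR).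
  exists e => //; apply/negP => /setIdP[_ /eqP et].
  have : ((1^-1 * e) ^+ t = 1)%g by rewrite invg1 mul1g.
  move/(multiples_expg_eq1 (x := 1%g) t nMR eM (esym (muln0 M))).
  rewrite subr0 mul1r modz_small ?ltz_nat// => -[t00].
  by rewrite t00 in t0.
have [g pg gH] := aper _ x HtL xL.
have gL := suppL _ pg.
have gt : ((x^-1 * g) ^+ t)%g <> 1%g.
  move=> gt; move/negP: gH; apply; apply/setIdP.
  by rewrite gt groupM ?groupV.
have mE : measurable [set w | (((Y w)%:Z - a%:Z) * t%:Z %% R%:Z)%Z = 0].
  exact: (measurable_funPTI Y
    (Y := [set y | ((y%:Z - a%:Z) * t%:Z %% R%:Z)%Z = 0])).
have mXg : measurable (X @^-1` [set (g : nat)]) by exact: measurable_funPTI.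
apply: (@le_lt_trans _ _ (P (~` (X @^-1` [set (g : nat)])))).
  apply: le_measure; rewrite ?inE//; first exact: measurableC.
  move=> w /= Ew Xg; apply: gt.
  apply/(multiples_expg_eq1 (y := Y w) (a := a) _ nMR) => //.
  rewrite ?YE Xg mulnC divnK//.
  by move: gL; rewrite inE.
rewrite probability_setC// nat_pmfE -EFinB lte_fin ltrBlDr ltrDl.
exact: pg.
Qed.

(** A proper subgroup [H] of the multiples of [M] is handled with [t = #|H|],
    for which [h ^+ t = 1] for all [h] in [H]. *)
Lemma domain_attraction_sufficient (Y : {RV P >-> nat}) :
  {ae P, forall w, X w = (M * Y w)%N} ->
  (forall a t : nat, (a < R)%N -> (0 < t < R)%N ->
    (P [set w | ((((Y w)%:Z - a%:Z) * t%:Z) %% R%:Z)%Z = 0%R] < 1)%E) ->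
  forall g, convpow p m g @[m --> \oo] -->
    ((g \in multiples n M)%:R / R%:R : K).
Proof.
move=> XY nper g.
have Mn : (M %| n.+1)%N by rewrite nMR dvdn_mulr.
pose L := multiples_group Mn.
have cardL : #|L| = R by rewrite (card_multiples nMR).
have p0 k : 0 <= p k by apply: nat_pmf_ge0.
have mX A : measurable (X @^-1` A) by exact: measurable_funPTI.
have suppL k : 0 < p k -> k \in L.
  rewrite -lte_fin -nat_pmfE => Pk.
  have [w [/= Xk XYw]] := ae_witness (mX _) Pk XY.
  by rewrite inE -Xk XYw dvdn_mulr.
rewrite -cardL.
apply: (@convpow_cvg _ _ p L) => // [|H x HL xL].
  exact: nat_pmf_sum1.
apply: contrapT => nex.
have pH k : 0 < p k -> (x^-1 * k)%g \in H.
  by move=> pk; apply: contrapT => /negP kH; apply: nex; exists k.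
pose t := #|H|; pose a := (x %/ M)%N.
have xa : (x : nat) = (M * a)%N.
  by rewrite /a mulnC divnK//; move: xL; rewrite inE.
have aR : (a < R)%N by rewrite /a ltn_divLR// mulnC -nMR.
have tR : (0 < t < R)%N by rewrite cardG_gt0 -cardL proper_card.
pose E := [set w | (((Y w)%:Z - a%:Z) * t%:Z %% R%:Z)%Z = 0].
have mE : measurable E.
  exact: (measurable_funPTI Y
    (Y := [set y | ((y%:Z - a%:Z) * t%:Z %% R%:Z)%Z = 0])).
have mEC : measurable (~` E) by exact: measurableC.
have PE := nper a t aR tR.
have PEC : (0 < P (~` E))%E by rewrite probability_setC// sube_gt0.
have [j Pj] : exists j : 'I_n.+1, (0 < P (~` E `&` X @^-1` [set (j : nat)]))%E.
  apply: contrapT => nj; move: PEC.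
  have mXf : measurable_fun setT X by [].
  rewrite -[~` E]setIT -(preimage_setT X) (prob_split _ mXf X_lt)// big1 ?ltxx//.
  move=> j _; apply/eqP; rewrite eq_le measure_ge0 andbT leNgt.
  by apply/negP => Pj; apply: nj; exists j.
have pj : 0 < p j.
  rewrite -lte_fin -nat_pmfE; apply: (lt_le_trans Pj).
  by apply: le_measure; rewrite ?inE//; exact: measurableI.
have mEj : measurable (~` E `&` X @^-1` [set (j : nat)]) by exact: measurableI.
have [w [[Ew /= Xj] XYw]] := ae_witness mEj Pj XY.
apply: Ew; apply/(multiples_expg_eq1 (g := j) _ nMR _ xa).
  by rewrite -Xj.
by rewrite expg_cardG// pH.
Qed.

End attraction.

Theorem theorem5 (K : realType) (N M R : nat)
    (N_gt0 : (0 < N)%N) (M_dvd_N : (M %| N)%N) (R_def : R = (N %/ M)%N)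
    (dU : measure_display) (TU : measurableType dU) (PU : probability TU K)
    (U : {RV PU >-> nat}) (U_unif : uniform_below R U)
    (d : measure_display) (T : measurableType d) (P : probability T K)
    (X : {RV P >-> nat}) (X_lt : forall w, (X w < N)%N) :
  in_domain_of_attraction N X PU (fun w => (M * U w)%N) <->
  exists Y : {RV P >-> nat},
    [/\ forall w, (Y w < R)%N,
        {ae P, forall w, X w = (M * Y w)%N} &
        forall a t : nat, (a < R)%N -> (0 < t < R)%N ->
          (P [set w | ((((Y w)%:Z - a%:Z) * t%:Z) %% R%:Z)%Z = 0%R] < 1)%E].
Proof.
case: N N_gt0 M_dvd_N R_def X_lt => // n _ Mn R_def X_lt.
have nMR : n.+1 = (M * R)%N by rewrite R_def mulnC divnK.
have PX : P (X @^-1` `I_n.+1) = 1%E.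
  rewrite -(probability_setT P); congr (P _).
  by apply/seteqP; split=> // w _; apply: X_lt.
rewrite (in_domain_of_attractionE nMR U_unif PX); split.
  exact: domain_attraction_necessary.
case=> Y [_ XY nper].
exact: domain_attraction_sufficient XY nper.
Qed.
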